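(* Let $X$ be an integral domain and let $f, g\colon X \to X$ be functions. Then $$g(x+y)-g(x)-g(y)=xf(y)+yf(x)\qquad\text{for all } x,y\in X$$ if and only if there exist two mappings $A_1, A_2\colon X\to X$ and a constant $c\in X$ such that $A_1$ and $2A_2$ are additive and $$4f(x)=2A_1(x)+2cx^2 \quad\text{and}\quad 6g(x)=A_2(x)+3xA_1(x)+cx^3\qquad\text{for all } x\in X.$$
   Context: An integral domain is a commutative unitary ring that contains no zero divisors. A function $h\colon X\to X$ is additive if $h(x+y)=h(x)+h(y)$ for all $x,y\in X$. For a positive integer $n$ and a function $h\colon X\to X$, $nh$ denotes the function $x\mapsto n\,h(x)$ (the $n$-fold sum). No regularity is assumed on $f$ and $g$.
   Formalization: The ''if'' direction is stated only when X has characteristic other than 2 and 3; in those characteristics it is false (f = 0, g = 1, A_1 = A_2 = 0, c = 0 satisfies the representation but not the equation). The ''only if'' direction holds for every integral domain. *)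

(* Defs.v *)
From HB Require Import structures.
From mathcomp Require Import all_boot all_order all_algebra.

Set Implicit Arguments.
Unset Strict Implicit.
Unset Printing Implicit Defensive.
Import GRing.Theory.
Local Open Scope ring_scope.

Definition cubic_equation (X : idomainType) (f g : X -> X) : Prop :=
  forall x y, g (x + y) - g x - g y = x * f y + y * f x.

Definition cubic_representation (X : idomainType) (f g : X -> X) : Prop :=
  exists (A1 A2 : X -> X) (c : X),
    [/\ {morph A1 : x y / x + y},
        {morph (fun x => A2 x *+ 2) : x y / x + y},
        forall x, f x *+ 4 = A1 x *+ 2 + (c * x ^+ 2) *+ 2
      & forall x, g x *+ 6 = A2 x + (x * A1 x) *+ 3 + c * x ^+ 3].

(* In characteristic 2 or 3 the representation says nothing about g, and it
   does not imply the equation: take f = 0 and g = 1. *)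
Lemma representation_not_sufficient (X : idomainType) :
  (2%N \in [pchar X]) || (3%N \in [pchar X]) ->
  exists f g : X -> X, cubic_representation f g /\ ~ cubic_equation f g.
Proof.
move=> chX; exists (fun=> 0), (fun=> 1); split; last first.
  move/(_ 0 0); rewrite subrr sub0r !mulr0 addr0 => /eqP.
  by rewrite oppr_eq0 oner_eq0.
have six0 : (6 : X) = 0.
  case/orP: chX => /andP[_ /eqP ch0].
    by rewrite -[6%N]/(2 * 3)%N mulrnA ch0 mul0rn.
  by rewrite -[6%N]/(3 * 2)%N mulrnA ch0 mul0rn.
exists (fun=> 0), (fun=> 0), 0; split=> [x y|x y|x|x] /=.
- by rewrite addr0.
- by rewrite mul0rn addr0.
- by rewrite mul0r !mul0rn addr0.
- by rewrite mulr0 mul0r mul0rn !addr0 six0.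
Qed.

(* Main.v *)
Require Import Defs.
From mathcomp Require Import all_boot all_order all_algebra.
From mathcomp Require Import ring.
Import GRing.Theory.
Local Open Scope ring_scope.

(** The right-hand side [x * f y + y * f x] is a coboundary, hence satisfies the
    cocycle identity, which reads [z * D x y = x * D y z] for the Cauchy
    difference [D] of [f]. Setting variables to [1] gives [D x y = d * x * y]
    with [d = D 1 1], so that [A1 x = 2 f x - d x^2] and
    [A2 x = 6 g x - 6 x f x + 2 d x^3] are additive. The converse is a direct
    computation after multiplication by [12]. *)

Lemma cubic_equation_cauchy_difference {X : idomainType} {f g : X -> X} :
  cubic_equation f g ->
  exists d, forall x y, f (x + y) = f x + f y + d * x * y.
Proof.
move=> eq_fg; pose D x y := f (x + y) - f x - f y.
have cocycle x y z : z * D x y = x * D y z.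
  apply/eqP; rewrite -subr_eq0; apply/eqP; rewrite /D.
  have gD u v : g (u + v) = g u + g v + (u * f v + v * f u).
    by rewrite -eq_fg; ring.
  (* Expanding [g] at [x + (y + z)] and at [(x + y) + z] yields two sums whose difference is the
     cocycle identity. *)
  have := congr1 g (addrA x y z); rewrite !gD => /eqP.
  rewrite eq_sym -subr_eq0 => /eqP <-; ring.
exists (D 1 1) => x y.
have := cocycle x y 1; have := cocycle y 1 1; rewrite !mul1r => -> Dxy.
have -> : D 1 1 * x * y = D x y by rewrite Dxy; ring.
rewrite /D; ring.
Qed.

Lemma cubic_equation_representation {X : idomainType} {f g : X -> X} :
  cubic_equation f g -> cubic_representation f g.
Proof.
move=> eq_fg; have [d fD] := cubic_equation_cauchy_difference eq_fg.
have gD x y : g (x + y) = g x + g y + (x * f y + y * f x).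
  by rewrite -eq_fg; ring.
(* With [c = d], the second witness is [6g - 3x A1 - d x^3] expanded. *)
exists (fun x => f x *+ 2 - d * x ^+ 2),
  (fun x => g x *+ 6 - (x * f x) *+ 6 + (d * x ^+ 3) *+ 2), d.
by split=> [x y|x y|x|x] /=; rewrite ?gD ?fD; ring.
Qed.

Lemma cubic_representation_equation {X : idomainType} {f g : X -> X} :
  2%N \notin [pchar X] -> 3%N \notin [pchar X] ->
  cubic_representation f g -> cubic_equation f g.
Proof.
rewrite !inE /= => two_neq0 three_neq0 [A1 [A2 [c [A1D A2D fE gE]]]] x y.
(* Only [2 A2] is additive, so [6g] is doubled; [4f] is tripled to match. *)
have twelve_neq0 : (12%:R : X) != 0.
  have -> : (12%:R : X) = 2%:R * 2%:R * 3%:R by ring.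
  by rewrite !mulf_neq0.
apply: (mulfI twelve_neq0).
have g12 z : 12%:R * g z = A2 z *+ 2 + (z * A1 z) *+ 6 + (c * z ^+ 3) *+ 2.
  have -> : 12%:R * g z = g z *+ 6 *+ 2 by ring.
  by rewrite gE; ring.
have f12 z : 12%:R * f z = A1 z *+ 6 + (c * z ^+ 2) *+ 6.
  have -> : 12%:R * f z = f z *+ 4 *+ 3 by ring.
  by rewrite fE; ring.
have -> : 12%:R * (x * f y + y * f x) = x * (12%:R * f y) + y * (12%:R * f x).
  by ring.
by rewrite !mulrBr !g12 !f12 A2D A1D; ring.
Qed.

(** The converse excludes characteristics 2 and 3, where [representation_not_sufficient] refutes
    it. *)
Theorem theorem3p1 (X : idomainType) (f g : X -> X) :
  (cubic_equation f g -> cubic_representation f g) /\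
  (2%N \notin [pchar X] -> 3%N \notin [pchar X] ->
   cubic_representation f g -> cubic_equation f g).
Proof.
split; first exact: cubic_equation_representation.
exact: cubic_representation_equation.
Qed.
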